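(* Let $\mathcal{P}\in\mathcal{Q}_n$ be an irreducible, tridiagonal sign pattern with a $0$-diagonal, where $n\le 5$. Then $\mathcal{P}$ is consistent if and only if $\mathcal{P}$ does not allow repeated real eigenvalues (i.e., no matrix in $\mathcal{Q}(\mathcal{P})$ has a real eigenvalue of algebraic multiplicity at least $2$).
   Context: A sign pattern is a matrix with entries in $\{+,-,0\}$; $\mathcal{Q}_n$ is the set of $n\times n$ sign patterns. The qualitative class $\mathcal{Q}(\mathcal{P})$ of $\mathcal{P}=[p_{ij}]$ is the set of real $n\times n$ matrices $A=[a_{ij}]$ with $\mathrm{sgn}(a_{ij})=p_{ij}$ for all $i,j$. $\mathcal{P}$ is tridiagonal if $p_{ij}=0$ whenever $|i-j|>1$; an irreducible tridiagonal pattern has $p_{i,i+1}\neq0$ and $p_{i+1,i}\neq0$ for all $i$; ''$0$-diagonal'' means $p_{ii}=0$ for all $i$. $\mathcal{P}$ is consistent if there is $k$ such that every $A\in\mathcal{Q}(\mathcal{P})$ has exactly $k$ real eigenvalues (counted with algebraic multiplicity). *)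

(* Defs.v *)
From HB Require Import structures.
From mathcomp Require Import all_boot all_order all_fingroup all_algebra.
From mathcomp Require Import polyrcf reals.

Set Implicit Arguments.
Unset Strict Implicit.
Unset Printing Implicit Defensive.

Import Order.TTheory GRing.Theory Num.Theory.
Local Open Scope ring_scope.

Inductive sign : Type := Plus | Minus | Zero.

Definition sgn (R : realDomainType) (x : R) : sign :=
  if 0 < x then Plus else if x < 0 then Minus else Zero.

Definition sign_pattern (n : nat) : Type := 'M[sign]_n.

Definition in_qualitative_class (R : realDomainType) (n : nat)
    (P : sign_pattern n) (A : 'M[R]_n) : Prop :=
  forall i j, sgn (A i j) = P i j.

Definition tridiagonal (n : nat) (P : sign_pattern n) : Prop :=
  forall i j : 'I_n, (1 < `|i - j|)%N -> P i j = Zero.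

Definition zero_diagonal (n : nat) (P : sign_pattern n) : Prop :=
  forall i : 'I_n, P i i = Zero.

(* A simultaneous permutation of rows and columns brings P to the form
   [* *; 0 *] with square diagonal blocks of sizes k and n - k.  Every 1 x 1
   pattern is irreducible under this convention, including the zero one. *)
Definition reducible (n : nat) (P : sign_pattern n) : Prop :=
  exists (s : 'S_n) (k : nat), (0 < k < n)%N /\
    forall i j : 'I_n, (k <= i)%N -> (j < k)%N -> P (s i) (s j) = Zero.

Definition irreducible (n : nat) (P : sign_pattern n) : Prop :=
  ~ reducible P.

Definition alg_mult (R : fieldType) (n : nat) (A : 'M[R]_n) (x : R) : nat :=
  mup x (char_poly A).

(* [rootsR p] lists each root of p in R once. *)
Definition num_real_eigenvalues (R : rcfType) (n : nat) (A : 'M[R]_n) : nat :=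
  (\sum_(x <- rootsR (char_poly A)) alg_mult A x)%N.

Definition consistent (R : rcfType) (n : nat) (P : sign_pattern n) : Prop :=
  exists k : nat, forall A : 'M[R]_n,
    in_qualitative_class P A -> num_real_eigenvalues A = k.

Definition allows_repeated_real_eigenvalues (R : rcfType) (n : nat)
    (P : sign_pattern n) : Prop :=
  exists (A : 'M[R]_n) (x : R),
    [/\ in_qualitative_class P A, eigenvalue A x & (2 <= alg_mult A x)%N].

(* Main.v *)
(* The spectrum of an n x n hollow tridiagonal matrix A depends only on the
   couplings c_k = a_(k,k+1) a_(k+1,k), and the matrices of the class realize
   exactly the tuples (c_k) with prescribed nonzero signs.  For n = 4 the
   characteristic polynomial is X^4 - t X^2 + u, and for n = 5 it is X times
   such a biquadratic, with discriminant t^2 - 4u =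
   (c_0 + c_1 - c_2 - c_3)^2 + 4 c_1 c_2 (where c_3 = 0 if n = 4).  For each
   choice of signs, either the signs alone force simple real roots in constant
   number, or explicit couplings give both a repeated real root and two
   different numbers of real roots.  The second case occurs when c_0 c_1 < 0
   (n = 3), when c_0 c_1 < 0 < c_0 c_2 (n = 4), and when c_0 c_1 < 0 or
   c_2 c_3 < 0 (n = 5, where u can then be made to vanish). *)
Require Import Defs.
From mathcomp Require Import all_boot all_order all_fingroup all_algebra.
From mathcomp Require Import reals.
From mathcomp Require Import polyrcf ring lra zify.

Set Implicit Arguments.
Unset Strict Implicit.
Unset Printing Implicit Defensive.

Import Order.TTheory GRing.Theory Num.Theory.
Local Open Scope ring_scope.

(** * Tridiagonal determinants with constant diagonal as continuants *)

Section Continuant.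
Variable R : comNzRingType.
Implicit Types b d c : nat -> R.

(** The superdiagonal is indexed by rows and the subdiagonal by columns, so that [b k] and [d k] are
    the two entries joining the indices [k] and [k.+1]. *)
Definition tridiag_mx n (x : R) b d : 'M[R]_n :=
  \matrix_(i, j) (if i == j :> nat then x
                  else if j == i.+1 :> nat then b i
                  else if i == j.+1 :> nat then d j else 0).

(** Laplace expansion along the first row leaves two minors, the second of which is expanded along
    its first column. *)
Lemma det_tridiag_mx_rec n x b d :
  \det (tridiag_mx n.+2 x b d) =
  x * \det (tridiag_mx n.+1 x (b \o succn) (d \o succn))
  - (b 0%N * d 0%N) * \det (tridiag_mx n x (b \o succn \o succn) (d \o succn \o succn)).
Proof.
rewrite (expand_det_row _ ord0) !big_ord_recl big1 => [|i _]; last first.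
  by rewrite !mxE /= mul0r.
rewrite addr0 /cofactor !mxE /= expr0 mul1r expr1 mulN1r mulrN.
congr (_ * \det _ - _); first by apply/matrixP => i j; rewrite !mxE /bump /=.
rewrite (expand_det_col _ ord0) big_ord_recl big1 => [|i _]; last first.
  by rewrite !mxE /= mul0r.
rewrite addr0 /cofactor !mxE /= expr0 mul1r mulrA; congr (_ * \det _).
by apply/matrixP => i j; rewrite !mxE /bump /=.
Qed.

(** The weighted matching polynomial of the path on [n] vertices, [c k] being the weight of the edge
    between [k] and [k.+1]. *)
Fixpoint path_poly n c : {poly R} :=
  match n with
  | 0 => 1
  | m.+1 => match m with
            | 0 => 'X
            | m'.+1 => 'X * path_poly m (c \o succn)
                       - (c 0%N)%:P * path_poly m' (c \o succn \o succn)
            end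
  end.

End Continuant.

Lemma det_tridiag_mx_path (R : comNzRingType) n (b d : nat -> R) :
  \det (tridiag_mx n 'X (fun k => - (b k)%:P) (fun k => - (d k)%:P)) =
  path_poly n (fun k => b k * d k).
Proof.
elim/ltn_ind: n b d => -[|[|n]] IH b d; first by rewrite det_mx00.
  by rewrite det_mx11 mxE.
rewrite det_tridiag_mx_rec.
rewrite (IH n.+1 _ (b \o succn) (d \o succn)) //.
rewrite (IH n _ (b \o succn \o succn) (d \o succn \o succn)) ?ltnS ?leqnSn //.
by rewrite mulrNN -polyCM.
Qed.

(** * Real roots counted with multiplicity *)

Section RealRoots.
Variable R : rcfType.
Implicit Types (p q : {poly R}) (s : seq R) (c : nat -> R).

(** The rootless cofactor makes [s] the full multiset of real roots, so that their number and their
    simplicity can be read off a list. *)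
Definition real_roots p s :=
  exists2 q, p = \prod_(a <- s) ('X - a%:P) * q & forall x, ~~ root q x.

Lemma real_roots_neq0 p s : real_roots p s -> p != 0.
Proof.
case=> q -> hq; rewrite mulf_neq0 //; last first.
  by apply: contra (hq 0) => /eqP->; rewrite root0.
by rewrite prodf_seq_neq0; apply/allP => a _ /=; rewrite polyXsubC_eq0.
Qed.

Lemma real_roots_mup p s x : real_roots p s -> mup x p = count_mem x s.
Proof. by case=> q -> hq; rewrite mupMl ?mu_prod_XsubC. Qed.

Lemma real_roots_size p s :
  real_roots p s -> (\sum_(x <- rootsR p) mup x p)%N = size s.
Proof.
move=> hs; have p0 := real_roots_neq0 hs.
have ur : uniq (rootsR p) by exact: uniq_roots.
under eq_bigr do rewrite (real_roots_mup _ hs).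
have hin : {subset s <= rootsR p}.
  move=> x xs; rewrite -roots_on_rootsR //= ?in_itv /=.
  rewrite rootE; case: hs => q -> _.
  by rewrite hornerM (eqP (_ : root (\prod_(a <- s) ('X - a%:P)) x)) ?mul0r // root_prod_XsubC.
(* Here [p] stays fixed while [s] shrinks, so only the inclusion in [rootsR p] is carried along;
   each element of [s] adds one to exactly one summand. *)
elim: s hin {hs} => [|a s IH] hin; first by rewrite big1.
rewrite /= big_split /= IH; last by move=> x xs; apply: hin; rewrite inE xs orbT.
rewrite -add1n; congr (_ + _)%N; rewrite (bigD1_seq a) ?hin ?mem_head //= eqxx big1 // => i.
by rewrite eq_sym => /negbTE->.
Qed.

Lemma real_roots_nil p : (forall x, 0 < p.[x]) -> real_roots p [::].
Proof.
by move=> hp; exists p; rewrite ?big_nil ?mul1r // => x; rewrite rootE gt_eqF.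
Qed.

Lemma real_roots_X p s : real_roots p s -> real_roots ('X * p) (0 :: s).
Proof. by case=> q -> hq; exists q; rewrite // big_cons subr0 mulrA. Qed.

Lemma real_roots_sqr p s a :
  real_roots p s -> real_roots (('X^2 - (a ^+ 2)%:P) * p) [:: a, - a & s].
Proof.
case=> q -> hq; exists q => //; rewrite !big_cons polyCN expr2 polyCM.
by move: (\prod_(_ <- _) _) => w; ring.
Qed.

(** * Real roots of biquadratic and even quadratic polynomials *)

Definition biquadratic (t u : R) : {poly R} := 'X^4 - t%:P * 'X^2 + u%:P.

Lemma horner_biquadratic t u x :
  (biquadratic t u).[x] = (x ^+ 2) ^+ 2 - t * x ^+ 2 + u.
Proof. by rewrite !hornerE -exprM. Qed.

(** The sign convention of [biquadratic] makes its parameters the sum and the product of the two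
    roots in the unknown [X^2]. *)
Lemma biquadratic_factor y z :
  biquadratic (y + z) (y * z) = ('X^2 - y%:P) * ('X^2 - z%:P).
Proof. rewrite /biquadratic polyCD polyCM; ring. Qed.

Lemma biquadratic_splits t u : 4 * u <= t ^+ 2 ->
  exists y z : R, [/\ t = y + z, u = y * z & z <= y].
Proof.
move=> h; have hs : Num.sqrt (t ^+ 2 - 4 * u) ^+ 2 = t ^+ 2 - 4 * u.
  by rewrite sqr_sqrtr // subr_ge0.
have := sqrtr_ge0 (t ^+ 2 - 4 * u).
move: (Num.sqrt _) hs => r hs hr.
exists ((t + r) / 2), ((t - r) / 2); split; [lra | nra | lra].
Qed.

(** The two roots in [X^2] have opposite signs, and only the positive one has real square roots. *)
Lemma biquadratic_neg t u : u < 0 ->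
  exists2 a, 0 < a & real_roots (biquadratic t u) [:: a; - a].
Proof.
move=> u0; have [|y [z [-> eu zy]]] := @biquadratic_splits t u.
  by have := sqr_ge0 t; lra.
subst u.
have y0 : 0 < y 
  by rewrite ltNge; apply/negP => y0; move: u0; rewrite ltNge mulr_le0 // (le_trans zy).
have z0 : z < 0 by rewrite -(pmulr_rlt0 _ y0).
exists (Num.sqrt y); first by rewrite sqrtr_gt0.
rewrite biquadratic_factor -{1}(@sqr_sqrtr _ y) ?ltW //.
apply/real_roots_sqr/real_roots_nil => x; rewrite !hornerE.
by have := sqr_ge0 x; lra.
Qed.

Lemma biquadratic_nonreal t u : t ^+ 2 < 4 * u ->
  real_roots (biquadratic t u) [::].
Proof.
move=> h; apply/real_roots_nil => x; rewrite horner_biquadratic.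
by have := sqr_ge0 (x ^+ 2 - t / 2); nra.
Qed.

Lemma biquadratic_pos_le0 t u : 0 < u -> t <= 0 ->
  real_roots (biquadratic t u) [::].
Proof.
move=> u0 t0; apply/real_roots_nil => x; rewrite horner_biquadratic.
have := sqr_ge0 x; have := sqr_ge0 (x ^+ 2); nra.
Qed.

(** Both roots in [X^2] are positive. Strictness is tracked separately: it makes the four roots
    distinct, while the boundary case still counts four. *)
Lemma biquadratic_pos_gt0 t u : 0 < u -> 0 < t -> 4 * u <= t ^+ 2 ->
  exists a b : R, [/\ 0 < b, b <= a, 4 * u < t ^+ 2 -> b < a &
    real_roots (biquadratic t u) [:: a; - a; b; - b]].
Proof.
move=> u0 t0 h; have [y [z [et eu zy]]] := biquadratic_splits h.
have z0 : 0 < z by subst; nra.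
have y0 : 0 < y by lra.
exists (Num.sqrt y), (Num.sqrt z); split.
- by rewrite sqrtr_gt0.
- exact: ler_wsqrtr.
- by move=> ?; rewrite ltr_sqrt // lt_neqAle zy andbT; apply/eqP; subst; nra.
rewrite et eu biquadratic_factor.
rewrite -{1}(@sqr_sqrtr _ y) ?ltW // -{1}(@sqr_sqrtr _ z) ?ltW //.
apply: real_roots_sqr; rewrite -[_ - _]mulr1; apply/real_roots_sqr/real_roots_nil => x.
by rewrite hornerE.
Qed.

(** Meant for comparison with [biquadratic_neg], which gives two roots: for positive [u] the roots
    in [X^2] are either nonreal or of equal sign. *)
Lemma biquadratic_pos_size t u : 0 < u ->
  exists2 s, real_roots (biquadratic t u) s & size s != 2.
Proof.
move=> u0; have [h|h] := ltP (t ^+ 2) (4 * u).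
  by exists [::] => //; exact: biquadratic_nonreal.
have [t0|t0] := leP t 0; first by exists [::] => //; exact: biquadratic_pos_le0.
have [a [b [_ _ _ hs]]] := biquadratic_pos_gt0 u0 t0 h.
by exists [:: a; - a; b; - b].
Qed.

Lemma real_roots_quadratic_pos t : 0 < t ->
  exists2 a, 0 < a & real_roots ('X^2 - t%:P) [:: a; - a].
Proof.
move=> t0; exists (Num.sqrt t); first by rewrite sqrtr_gt0.
rewrite -{1}(@sqr_sqrtr _ t) ?ltW // -[_ - _]mulr1.
by apply/real_roots_sqr/real_roots_nil => x; rewrite hornerE.
Qed.

Lemma real_roots_quadratic_neg t : t < 0 -> real_roots ('X^2 - t%:P) [::].
Proof.
move=> t0; apply/real_roots_nil => x; rewrite !hornerE.
by have := sqr_ge0 x; lra.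
Qed.

Lemma real_roots_quadratic_opp t : t != 0 -> exists s s',
  [/\ real_roots ('X^2 - t%:P) s, real_roots ('X^2 - (- t)%:P) s'
    & size s != size s'].
Proof.
case: ltgtP => // t0 _.
  have [|a _ hs] := @real_roots_quadratic_pos (- t); first by rewrite oppr_gt0.
  by exists [::], [:: a; - a]; split=> //; exact: real_roots_quadratic_neg.
have [//|a _ hs] := @real_roots_quadratic_pos t.
exists [:: a; - a], [::]; split=> //.
by apply: real_roots_quadratic_neg; rewrite oppr_lt0.
Qed.

Lemma uniq_opp2 (a : R) : 0 < a -> uniq [:: 0; a; - a].
Proof.
move=> a0; rewrite /= !inE !negb_or !andbT.
by do !(apply/andP; split); apply/eqP; lra.
Qed.

Lemma uniq_opp4 (a b : R) : 0 < b -> b < a -> uniq [:: 0; a; - a; b; - b].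
Proof.
move=> b0 ab; rewrite /= !inE !negb_or !andbT.
by do !(apply/andP; split); apply/eqP; lra.
Qed.

(** * Explicit path polynomials on two to five vertices *)

Lemma path_poly2 c : path_poly 2 c = 'X^2 - (c 0%N)%:P.
Proof. by rewrite /= mulr1 -expr2. Qed.

Lemma path_poly3 c : path_poly 3 c = 'X * ('X^2 - (c 0%N + c 1%N)%:P).
Proof. rewrite /= polyCD; ring. Qed.

Lemma path_poly4 c :
  path_poly 4 c = biquadratic (c 0%N + c 1%N + c 2%N) (c 0%N * c 2%N).
Proof. rewrite /biquadratic /= !polyCD polyCM; ring. Qed.

Lemma path_poly5 c :
  path_poly 5 c = 'X * biquadratic (c 0%N + c 1%N + c 2%N + c 3%N)
                         (c 0%N * c 2%N + c 0%N * c 3%N + c 1%N * c 3%N).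
Proof. rewrite /biquadratic /= !polyCD !polyCM; ring. Qed.

(** * The sign dichotomy for at most four vertices *)

Definition same_signs n c c' := forall k, (k < n)%N -> 0 < c k * c' k.

Lemma same_signs_gt0 n c c' k : same_signs n c c' -> 0 < c k -> (k < n)%N ->
  0 < c' k.
Proof. by move=> h ck /h; rewrite pmulr_rgt0. Qed.

Lemma same_signs_lt0 n c c' k : same_signs n c c' -> c k < 0 -> (k < n)%N ->
  c' k < 0.
Proof. by move=> h ck /h; rewrite nmulr_rgt0. Qed.

Lemma same_signs_mul_gt0 n c c' i j : same_signs n c c' -> 0 < c i * c j ->
  (i < n)%N -> (j < n)%N -> 0 < c' i * c' j.
Proof.
move=> h cij /h hi /h hj; have := mulr_gt0 hi hj.
by rewrite mulrACA pmulr_rgt0.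
Qed.

Lemma same_signs_mul_lt0 n c c' i j : same_signs n c c' -> c i * c j < 0 ->
  (i < n)%N -> (j < n)%N -> c' i * c' j < 0.
Proof.
move=> h cij /h hi /h hj; have := mulr_gt0 hi hj.
by rewrite mulrACA nmulr_rgt0.
Qed.

Definition constant_simple_roots n c :=
  exists m, forall c', same_signs n c c' ->
    exists2 s, real_roots (path_poly n.+1 c') s & uniq s /\ size s = m.

Definition varying_repeated_roots n c :=
  (exists c' x, same_signs n c c' /\ ('X - x%:P) ^+ 2 %| path_poly n.+1 c')
  /\ exists c1 c2 s1 s2, [/\ same_signs n c c1, same_signs n c c2,
       real_roots (path_poly n.+1 c1) s1, real_roots (path_poly n.+1 c2) s2
     & size s1 != size s2].

(** Each alternative settles both sides of the equivalence: the first makes both hold, the second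
    makes both fail. *)
Definition dichotomy n c := constant_simple_roots n c \/ varying_repeated_roots n c.

Lemma dichotomy0 c : dichotomy 0 c.
Proof.
left; exists 1%N => c' _; exists [:: 0] => //=.
rewrite -['X]mulr1; apply/real_roots_X/real_roots_nil => x.
by rewrite hornerE.
Qed.

Lemma dichotomy1 c : c 0%N != 0 -> dichotomy 1 c.
Proof.
case: ltgtP => // h _; left; [exists 0%N|exists 2%N] => c' hc; rewrite path_poly2.
  exists [::] => //; apply: real_roots_quadratic_neg.
  exact: same_signs_lt0 hc h isT.
have [//|a a0 hs] := @real_roots_quadratic_pos (c' 0%N).
  exact: same_signs_gt0 hc h isT.
by exists [:: a; - a] => //; split=> //; have /andP[] := uniq_opp2 a0.
Qed.

(** Couplings of equal sign fix the sign of their sum in [path_poly3]; couplings of opposite signs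
    let the sum be zero, positive or negative. *)
Lemma dichotomy2 c : c 0%N != 0 -> c 1%N != 0 -> dichotomy 2 c.
Proof.
move=> h0 h1; have : c 0%N * c 1%N != 0 by rewrite mulf_neq0.
case: ltgtP => // h _; last first.
  left; case: ltgtP h0 => // h0 _.
    exists 1%N => c' hc; exists [:: 0] => //; rewrite path_poly3.
    apply/real_roots_X/real_roots_quadratic_neg.
    have h1' : c 1%N < 0 by rewrite -(nmulr_rgt0 _ h0).
    have := same_signs_lt0 hc h0 isT; have := same_signs_lt0 hc h1' isT; lra.
  exists 3%N => c' hc; rewrite path_poly3.
  have h1' : 0 < c 1%N by rewrite -(pmulr_rgt0 _ h0).
  have := same_signs_gt0 hc h0 isT; have := same_signs_gt0 hc h1' isT => p1 p0.
  have [|a a0 hs] := @real_roots_quadratic_pos (c' 0%N + c' 1%N); first by lra.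
  exists [:: 0; a; - a]; first exact: real_roots_X.
  by split=> //; exact: uniq_opp2.
right.
have sc x y : 0 < x -> 0 < y ->
    same_signs 2 c (nth 0 [:: x * c 0%N; - (y * c 0%N)]).
  have cc : 0 < c 0%N ^+ 2 by rewrite exprn_even_gt0.
  move=> x0 y0 [|[|//]] _ /=; first by rewrite mulrCA mulr_gt0.
  by rewrite mulrN mulrCA [c 1%N * _]mulrC -mulrN mulr_gt0 ?oppr_gt0.
split.
  (* Opposite couplings cancel and leave [X^3]. *)
  exists (nth 0 [:: 1 * c 0%N; - (1 * c 0%N)]), 0; split; first by apply: sc; lra.
  by rewrite path_poly3 /= subrr !subr0 dvdp_mull.
have [s [s' [hs hs' ss']]] := real_roots_quadratic_opp h0.
(* The two sums are [c 0] and [- c 0], exactly one of which is positive. *)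
exists (nth 0 [:: 2 * c 0%N; - (1 * c 0%N)]), (nth 0 [:: 1 * c 0%N; - (2 * c 0%N)]).
exists (0 :: s), (0 :: s'); split; rewrite ?path_poly3 /=; try by apply: sc; lra.
- by apply: real_roots_X; congr (real_roots ('X^2 - _%:P) _): hs; ring.
- by apply: real_roots_X; congr (real_roots ('X^2 - _%:P) _): hs'; ring.
- by rewrite eqSS.
Qed.

Lemma dichotomy3 c : c 0%N != 0 -> c 1%N != 0 -> c 2%N != 0 -> dichotomy 3 c.
Proof.
move=> h0 h1 h2; have : c 0%N * c 2%N != 0 by rewrite mulf_neq0.
case: ltgtP => // h _.
  left; exists 2%N => c' hc; rewrite path_poly4.
  have [|a a0 hs] := @biquadratic_neg (c' 0%N + c' 1%N + c' 2%N) (c' 0%N * c' 2%N).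
    exact: same_signs_mul_lt0 hc h isT isT.
  by exists [:: a; - a] => //; split=> //; have /andP[] := uniq_opp2 a0.
have : c 0%N * c 1%N != 0 by rewrite mulf_neq0.
case: ltgtP => // h' _; [right | left].
  have n0 : 0 < `|c 0%N| by rewrite normr_gt0.
  have n2 : `|c 0%N| ^+ 2 = c 0%N ^+ 2 by rewrite real_normK ?num_real.
  have cc : 0 < c 0%N ^+ 2 by rewrite exprn_even_gt0.
  (* The sum is [r * |c 0|] and the product of the outer couplings is [4 * c 0 ^+ 2], so the
     discriminant is [(r ^+ 2 - 16) * c 0 ^+ 2]: zero at [r = 4], negative at [r = 0]. The
     coefficient 5 exceeds 4, which keeps the middle sign opposite to that of [c 0]. *)
  pose w r : nat -> R := nth 0 [:: 4 * c 0%N; r * `|c 0%N| - 5 * c 0%N; c 0%N].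
  have sw r : 0 <= r -> r <= 4 -> same_signs 3 c (w r).
    move=> r0 r4.
    have w1 : (r * `|c 0%N| - 5 * c 0%N) * c 0%N < 0.
      have : `|c 0%N| * c 0%N <= c 0%N ^+ 2.
        by rewrite -n2 expr2 ler_pM2l // ler_norm.
      nra.
    move=> [|[|[|//]]] _ /=; [by rewrite mulrCA mulr_gt0 | | by rewrite mulrC].
    by rewrite -(pmulr_lgt0 _ cc) expr2 mulrACA mulrC [_ * c 0%N]mulrC nmulr_rgt0 // mulrC.
  have w4 : path_poly 4 (w 4) = biquadratic (4 * `|c 0%N|) (4 * `|c 0%N| ^+ 2).
    by rewrite path_poly4 /w /= n2; congr biquadratic; ring.
  split.
    exists (w 4), (Num.sqrt (2 * `|c 0%N|)); split; first by apply: sw; lra.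
    rewrite w4 (_ : 4 * `|c 0%N| = 2 * `|c 0%N| + 2 * `|c 0%N|); last by ring.
    rewrite (_ : 4 * `|c 0%N| ^+ 2 = (2 * `|c 0%N|) * (2 * `|c 0%N|)); last by ring.
    rewrite biquadratic_factor -{2 3}(@sqr_sqrtr _ (2 * `|c 0%N|)) ?mulr_ge0 //.
    by rewrite polyC_exp subr_sqr -expr2 exprMn dvdp_mulr.
  have [|||a [b [_ _ _ hs]]] :=
    @biquadratic_pos_gt0 (4 * `|c 0%N|) (4 * `|c 0%N| ^+ 2); try nra.
  exists (w 4), (w 0), [:: a; - a; b; - b], [::].
  split; rewrite ?w4 //; try by apply: sw; lra.
  by rewrite path_poly4 /w /=; apply: biquadratic_nonreal; nra.
(* All couplings now share the sign of [c 0]: positive ones give four distinct roots, negative ones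
   give none. *)
exists (if (0 < c 0%N)%R then 4 else 0)%N => c' hc; rewrite path_poly4.
have u0 := same_signs_mul_gt0 hc h isT isT.
have v0 := same_signs_mul_gt0 hc h' isT isT.
case: ltgtP h0 => // h0 _.
  have c0 := same_signs_gt0 hc h0 isT.
  have c1 : 0 < c' 1%N by rewrite -(pmulr_rgt0 _ c0).
  have c2 : 0 < c' 2%N by rewrite -(pmulr_rgt0 _ c0).
  have d0 : 4 * (c' 0%N * c' 2%N) < (c' 0%N + c' 1%N + c' 2%N) ^+ 2.
    rewrite -subr_gt0 (_ : _ - _ = (c' 0%N + c' 1%N - c' 2%N) ^+ 2
      + 4 * (c' 1%N * c' 2%N)); last by ring.
    by rewrite ltr_wpDl ?sqr_ge0 // !mulr_gt0.
  have [|a [b [b0 _ ab hs]]] := biquadratic_pos_gt0 u0 _ (ltW d0); first by lra.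
  exists [:: a; - a; b; - b] => //; split=> //.
  by have /andP[] := uniq_opp4 b0 (ab d0).
have c0 := same_signs_lt0 hc h0 isT.
have c1 : c' 1%N < 0 by rewrite -(nmulr_rgt0 _ c0).
have c2 : c' 2%N < 0 by rewrite -(nmulr_rgt0 _ c0).
by exists [::] => //; apply: biquadratic_pos_le0 => //; lra.
Qed.

(** * The dichotomy for five vertices *)

Lemma dominant_sum (a b : R) : a != 0 -> b != 0 ->
  exists u v, [/\ 0 < a * u, 0 < b * v & 0 < (u + v) * v].
Proof.
(* In absolute value [v] is twice [u], so it dictates the sign of [u + v]. *)
move=> a0 b0; exists (a * `|b|), (2 * `|a| * b).
have na : 0 < `|a| by rewrite normr_gt0.
have nb : 0 < `|b| by rewrite normr_gt0.
have aa : 0 < a ^+ 2 by rewrite exprn_even_gt0.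
have bb : 0 < b ^+ 2 by rewrite exprn_even_gt0.
split; first by nra.
  by nra.
have h : - (a * b) <= `|a| * `|b| by rewrite -normrM -normrN ler_norm.
have ab : 0 < `|a| * `|b| by rewrite mulr_gt0.
have eb : b ^+ 2 = `|b| ^+ 2 by rewrite real_normK ?num_real.
have -> : (a * `|b| + 2 * `|a| * b) * (2 * `|a| * b) =
  2 * (`|a| * `|b|) * (2 * (`|a| * `|b|) - (- (a * b))).
  transitivity (2 * `|a| * (a * b * `|b| + 2 * `|a| * b ^+ 2)); first by ring.
  rewrite eb; ring.
by rewrite !mulr_gt0 //; lra.
Qed.

Lemma quintic_coef_vanishes c : (forall k, (k < 4)%N -> c k != 0) ->
  c 0%N * c 1%N < 0 \/ c 2%N * c 3%N < 0 ->
  exists2 c', same_signs 4 c c' &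
    c' 0%N * c' 2%N + c' 0%N * c' 3%N + c' 1%N * c' 3%N = 0.
Proof.
(* The coefficient is c'_0 (c'_2 + c'_3) + c'_1 c'_3; it is solved for the
   ratio c'_0 : c'_1, which is then cleared of denominators. *)
move=> c0 [h|h].
  have [u [v [hu hv huv]]] := dominant_sum (c0 2%N isT) (c0 3%N isT).
  exists (nth 0 [:: c 0%N * v ^+ 2; - (c 0%N * ((u + v) * v)); u; v]); last by rewrite /=; ring.
  have v2 : 0 < v ^+ 2 by rewrite exprn_even_gt0 //; apply: contraL hv => /eqP->; rewrite mulr0 ltxx.
  move=> [|[|[|[|//]]]] _ //=; last by nra.
  by rewrite mulrA pmulr_lgt0 // -expr2 exprn_even_gt0 // c0.
(* The mirror image of the first case, with the path read backwards. *)
have [u [v [hu hv huv]]] := dominant_sum (c0 1%N isT) (c0 0%N isT).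
exists (nth 0 [:: v; u; - (c 3%N * ((u + v) * v)); c 3%N * v ^+ 2]); last by rewrite /=; ring.
have v2 : 0 < v ^+ 2 by rewrite exprn_even_gt0 //; apply: contraL hv => /eqP->; rewrite mulr0 ltxx.
move=> [|[|[|[|//]]]] _ //=; first by nra.
by rewrite mulrA pmulr_lgt0 // -expr2 exprn_even_gt0 // c0.
Qed.

Lemma vanishing_quintic_varies c c' : same_signs 4 c c' ->
  c' 0%N * c' 2%N + c' 0%N * c' 3%N + c' 1%N * c' 3%N = 0 ->
  varying_repeated_roots 4 c.
Proof.
move=> hc q0; split.
  (* With [u = 0] the polynomial is divisible by [X^3], so 0 is a repeated root. *)
  exists c', 0; split => //.
  rewrite path_poly5 q0; move: (c' 0%N + _ + _ + _) => t.
  rewrite /biquadratic polyC0 (_ : 'X * _ = 'X^2 * ('X * ('X^2 - t%:P))); last by ring.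
  by rewrite subr0 dvdp_mulIl.
pose w r : nat -> R := nth 0 [:: c' 0%N; c' 1%N; c' 2%N; r * c' 3%N].
have sw r : 0 < r -> same_signs 4 c (w r).
  move=> r0 [|[|[|[|//]]]] _ /=; try exact: hc.
  by rewrite mulrCA mulr_gt0 // hc.
(* The constant term after scaling the last coupling by [r]; it changes sign at [r = 1]. On the
   negative side there are three real roots, on the positive side never three. *)
pose q r := (1 - r) * (c' 0%N * c' 2%N).
have qw r : exists t, path_poly 5 (w r) = 'X * biquadratic t (q r).
  exists (w r 0%N + w r 1%N + w r 2%N + w r 3%N).
  rewrite path_poly5 /w /q /=; congr ('X * biquadratic _ _).
  transitivity (c' 0%N * c' 2%N + r * (- (c' 0%N * c' 2%N)
    + (c' 0%N * c' 2%N + c' 0%N * c' 3%N + c' 1%N * c' 3%N))); first by ring.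
  by rewrite q0; ring.
have nz k : (k < 4)%N -> c' k != 0.
  by move=> /hc; apply: contraTneq => ->; rewrite mulr0 ltxx.
have [r [r' [r0 r0' qr qr']]] : exists r r', [/\ 0 < r, 0 < r', q r < 0 & 0 < q r'].
  have : c' 0%N * c' 2%N != 0 by rewrite mulf_neq0 ?nz.
  by case: ltgtP => // h _; [exists 2^-1, 2 | exists 2, 2^-1]; rewrite /q; split; lra.
have [t et] := qw r; have [t' et'] := qw r'.
have [a _ hs] := biquadratic_neg t qr.
have [s hs' ss] := biquadratic_pos_size t' qr'.
exists (w r), (w r'), [:: 0; a; - a], (0 :: s).
split; rewrite ?et ?et'; try exact: sw; try exact: real_roots_X.
by rewrite /= eqSS eq_sym.
Qed.

Lemma mulr_lt0_trans (x y z : R) : x * y < 0 -> 0 < y * z -> x * z < 0.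
Proof.
case: (ltgtP y 0) => [y0|y0|->]; last by rewrite mulr0 ltxx.
  by rewrite nmulr_llt0 // nmulr_rgt0 // => x0 z0; rewrite pmulr_rlt0.
by rewrite pmulr_llt0 // pmulr_rgt0 // => x0 z0; rewrite pmulr_llt0.
Qed.

Lemma dichotomy4 c : (forall k, (k < 4)%N -> c k != 0) -> dichotomy 4 c.
Proof.
move=> c0.
have n01 : c 0%N * c 1%N != 0 by rewrite mulf_neq0 ?c0.
have n23 : c 2%N * c 3%N != 0 by rewrite mulf_neq0 ?c0.
have [h|h01] := ltP (c 0%N * c 1%N) 0.
  have [c' hc q0] := quintic_coef_vanishes c0 (or_introl h).
  by right; exact: vanishing_quintic_varies hc q0.
have [h|h23] := ltP (c 2%N * c 3%N) 0.
  have [c' hc q0] := quintic_coef_vanishes c0 (or_intror h).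
  by right; exact: vanishing_quintic_varies hc q0.
have {}h01 : 0 < c 0%N * c 1%N by rewrite lt_def n01.
have {}h23 : 0 < c 2%N * c 3%N by rewrite lt_def n23.
left; have : c 0%N * c 2%N != 0 by rewrite mulf_neq0 ?c0.
case: ltgtP => // h02 _.
  have h03 := mulr_lt0_trans h02 h23.
  have h13 : c 1%N * c 3%N < 0.
    by rewrite mulrC in h03; rewrite mulrC (mulr_lt0_trans h03).
  (* All three products in the constant term of the biquadratic factor are negative. *)
  exists 3%N => c' hc; rewrite path_poly5.
  have l02 := same_signs_mul_lt0 hc h02 isT isT.
  have l03 := same_signs_mul_lt0 hc h03 isT isT.
  have l13 := same_signs_mul_lt0 hc h13 isT isT.
  have [|a a0 hs] := @biquadratic_neg (c' 0%N + c' 1%N + c' 2%N + c' 3%N)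
    (c' 0%N * c' 2%N + c' 0%N * c' 3%N + c' 1%N * c' 3%N); first by lra.
  exists [:: 0; a; - a]; first exact: real_roots_X.
  by split=> //; exact: uniq_opp2.
(* All four couplings share the sign of [c 0]: positive ones give five distinct roots, negative ones
   only the root 0. *)
exists (if (0 < c 0%N)%R then 5 else 1)%N => c' hc; rewrite path_poly5.
have l01 := same_signs_mul_gt0 hc h01 isT isT.
have l02 := same_signs_mul_gt0 hc h02 isT isT.
have l23 := same_signs_mul_gt0 hc h23 isT isT.
have [c0p|c0p|/eqP] := ltgtP (c 0%N) 0; last by rewrite (negbTE (c0 _ _)).
  have l0 := same_signs_lt0 hc c0p isT.
  have l1 : c' 1%N < 0 by rewrite -(nmulr_rgt0 _ l0).
  have l2 : c' 2%N < 0 by rewrite -(nmulr_rgt0 _ l0).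
  have l3 : c' 3%N < 0 by rewrite -(nmulr_rgt0 _ l2).
  exists [:: 0] => //; apply/real_roots_X/biquadratic_pos_le0; last by lra.
  by rewrite !addr_gt0 // nmulr_lgt0.
have l0 := same_signs_gt0 hc c0p isT.
have l1 : 0 < c' 1%N by rewrite -(pmulr_rgt0 _ l0).
have l2 : 0 < c' 2%N by rewrite -(pmulr_rgt0 _ l0).
have l3 : 0 < c' 3%N by rewrite -(pmulr_rgt0 _ l2).
set t := c' 0%N + _ + _ + _; set u := c' 0%N * _ + _ + _.
have d0 : 4 * u < t ^+ 2.
  rewrite -subr_gt0 (_ : _ - _ = (c' 0%N + c' 1%N - c' 2%N - c' 3%N) ^+ 2
    + 4 * (c' 1%N * c' 2%N)); last by rewrite /t /u; ring.
  by rewrite ltr_wpDl ?sqr_ge0 // !mulr_gt0.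
have [|||a [b [b0 _ ab hs]]] := @biquadratic_pos_gt0 t u.
- by rewrite /u !addr_gt0 // mulr_gt0.
- by rewrite /t !addr_gt0.
- exact: ltW.
exists [:: 0; a; - a; b; - b]; first exact: real_roots_X.
by split=> //; exact: uniq_opp4 b0 (ab d0).
Qed.

Lemma dichotomy_le4 n c : (n <= 4)%N -> (forall k, (k < n)%N -> c k != 0) ->
  dichotomy n c.
Proof.
case: n => [|[|[|[|[|//]]]]] _ c0; [exact: dichotomy0 | apply: dichotomy1 |
  apply: dichotomy2 | apply: dichotomy3 | exact: dichotomy4]; exact: c0.
Qed.

End RealRoots.

(** * Characteristic polynomials of hollow tridiagonal matrices *)

Lemma eq_path_poly (R : comNzRingType) n (c c' : nat -> R) :
  (forall k, (k.+1 < n)%N -> c k = c' k) -> path_poly n c = path_poly n c'.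
Proof.
elim/ltn_ind: n c c' => -[|[|n]] IH c c' cc' //.
rewrite [LHS]/= [RHS]/= -/(path_poly n.+1 _) -/(path_poly n.+1 _) cc' //.
rewrite (IH n.+1 _ (c \o succn) (c' \o succn)) //; last by move=> k hk; exact: cc'.
rewrite (IH n _ (c \o succn \o succn) (c' \o succn \o succn)) // => k hk.
exact: cc'.
Qed.

(** Only the values at [k < n] are meaningful, since [inord] sends an index out of range to 0. *)
Definition couplings (R : pzSemiRingType) n (A : 'M[R]_n.+1) (k : nat) : R :=
  A (inord k) (inord k.+1) * A (inord k.+1) (inord k).

(** The hypothesis covers the diagonal too, so the characteristic matrix is a [tridiag_mx] with ['X]
    on the diagonal. *)
Lemma char_poly_hollow_tridiag (R : comNzRingType) n (A : 'M[R]_n.+1) :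
  (forall i j : 'I_n.+1, j != i.+1 :> nat -> i != j.+1 :> nat -> A i j = 0) ->
  char_poly A = path_poly n.+1 (couplings A).
Proof.
move=> hA; rewrite -det_tridiag_mx_path /char_poly; congr (\det _).
apply/matrixP => i j; rewrite !mxE -val_eqE /=.
case: eqP => [ij|_].
  by rewrite hA ?subr0 ?mulr1n // ij neq_ltn ltnSn.
rewrite mulr0n sub0r; case: eqP => [ji|/eqP ji]; first by rewrite -ji !inord_val.
case: eqP => [ij|/eqP ij]; first by rewrite -ij !inord_val.
by rewrite hA // oppr0.
Qed.

(** * Qualitative classes and the couplings they realize *)

Section SignPatterns.
Variable R : realType.

Lemma sgn_eq0 (x : R) : sgn x = Zero -> x = 0.
Proof. by rewrite /sgn; case: ltgtP. Qed.

Lemma sgn_mulr (x t : R) : 0 < t -> sgn (x * t) = sgn x.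
Proof. by move=> t0; rewrite /sgn pmulr_lgt0 // pmulr_llt0. Qed.

Lemma sgn_eq_mul_gt0 (x y : R) : sgn x = sgn y -> x != 0 -> 0 < x * y.
Proof.
rewrite /sgn; case: (ltgtP x 0) => // x0; case: (ltgtP y 0) => // y0 _ _.
  by rewrite nmulr_rgt0.
by rewrite mulr_gt0.
Qed.

(** Supplies a reference matrix, whose couplings carry the signs to which the dichotomy is
    applied. *)
Lemma in_qualitative_class_nonempty n (P : sign_pattern n) :
  exists A : 'M[R]_n, in_qualitative_class P A.
Proof.
exists (map_mx (fun s => match s with Plus => 1 | Minus => -1 | Zero => 0 end) P).
move=> i j; rewrite mxE /sgn; case: (P i j).
- by rewrite ltr01.
- by rewrite ltr0N1 ltrN10.
- by rewrite ltxx.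
Qed.

Lemma irreducible_tridiagonal_neq0 n (P : sign_pattern n.+1) k :
  irreducible P -> tridiagonal P -> (k < n)%N ->
  P (inord k) (inord k.+1) <> Zero /\ P (inord k.+1) (inord k) <> Zero.
Proof.
move=> hirr htri kn; split=> P0; apply: hirr.
  (* A zero above the diagonal kills the upper right block; reversing the order moves it to the
     lower left, the first block then having the [n - k] indices above [k]. *)
  exists (perm (@rev_ord_inj n.+1)), (n - k)%N; split; first by lia.
  move=> i j hi hj; rewrite !permE.
  have [[vi vj]|h] : rev_ord i = k :> nat /\ rev_ord j = k.+1 :> nat \/
      (rev_ord i + 1 < rev_ord j)%N by rewrite /=; lia.
    by rewrite -P0 -vj -vi !inord_val.
  by apply: htri; move: h; lia.
(* A zero below the diagonal kills the lower left block without any permutation. *)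
exists 1%g, k.+1; split; first by lia.
move=> i j hi hj; rewrite !perm1.
have [[vi vj]|h] : i = k.+1 :> nat /\ j = k :> nat \/ (j + 1 < i)%N by lia.
  by rewrite -P0 -vi -vj !inord_val.
by apply: htri; lia.
Qed.

Variables (n : nat) (P : sign_pattern n.+1).
Hypotheses (hirr : irreducible P) (htri : tridiagonal P) (hdiag : zero_diagonal P).
Implicit Type A : 'M[R]_n.+1.

Lemma class_char_poly A : in_qualitative_class P A ->
  char_poly A = path_poly n.+1 (couplings A).
Proof.
move=> hA; apply: char_poly_hollow_tridiag => i j ji ij; apply: sgn_eq0; rewrite hA.
have [e|ne] := eqVneq i j; first by rewrite e hdiag.
by apply: htri; move: ji ij ne; rewrite -val_eqE /=; lia.
Qed.

Lemma class_entry_neq0 A k : in_qualitative_class P A -> (k < n)%N ->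
  A (inord k) (inord k.+1) != 0 /\ A (inord k.+1) (inord k) != 0.
Proof.
move=> hA kn; have [h1 h2] := irreducible_tridiagonal_neq0 hirr htri kn.
split; apply/eqP => A0; [move: h1 | move: h2]; rewrite -hA A0 /sgn ltxx; exact.
Qed.

Lemma class_couplings_neq0 A k : in_qualitative_class P A -> (k < n)%N ->
  couplings A k != 0.
Proof.
by move=> hA kn; have [? ?] := class_entry_neq0 hA kn; rewrite mulf_neq0.
Qed.

Lemma class_same_signs A A' : in_qualitative_class P A ->
  in_qualitative_class P A' -> same_signs n (couplings A) (couplings A').
Proof.
move=> hA hA' k kn; have [? ?] := class_entry_neq0 hA kn.
by rewrite /couplings mulrACA mulr_gt0 // sgn_eq_mul_gt0 // hA hA'.
Qed.

(** Rescaling each superdiagonal entry by the positive ratio of new to old coupling preserves all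
    signs. *)
Lemma class_realizes A c : in_qualitative_class P A ->
  same_signs n (couplings A) c ->
  exists2 A', in_qualitative_class P A' & char_poly A' = path_poly n.+1 c.
Proof.
move=> hA hc.
pose A' : 'M[R]_n.+1 := \matrix_(i, j)
  (if j == i.+1 :> nat then A i j * (c i / couplings A i) else A i j).
have hA' : in_qualitative_class P A'.
  move=> i j; rewrite mxE; case: eqP => [ji|_]; last exact: hA.
  have ilt : (i < n)%N by rewrite -ltnS -ji.
  (* The ratio is positive, being the product given by [same_signs] times the squared inverse of the
     old coupling. *)
  rewrite sgn_mulr ?hA //; have := hc _ ilt; rewrite mulrC.
  by rewrite -(pmulr_lgt0 _ (_ : 0 < (couplings A i)^-1 ^+ 2)) ?exprn_even_gt0
    ?invr_eq0 ?class_couplings_neq0 // -mulrA expr2 mulVKf ?class_couplings_neq0.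
exists A' => //; rewrite class_char_poly //; apply: eq_path_poly => k; rewrite ltnS => kn.
rewrite /couplings !mxE !inordK ?(ltnW kn) //; last by rewrite ltnS ltnW.
(* The subdiagonal entry keeps its value, so each coupling is rescaled only once. *)
rewrite eqxx (_ : (k == k.+2) = false); last by lia.
by rewrite mulrAC -/(couplings A k) mulrC divfK // class_couplings_neq0.
Qed.

Lemma constant_simple_consistent A : in_qualitative_class P A ->
  constant_simple_roots n (couplings A) ->
  consistent R P /\ ~ allows_repeated_real_eigenvalues R P.
Proof.
move=> hA [m hm].
have split A' : in_qualitative_class P A' ->
    exists2 s, real_roots (char_poly A') s & uniq s /\ size s = m.
  by move=> hA'; rewrite class_char_poly //; apply/hm/class_same_signs.
split.
  exists m => A' /split[s hs [_ <-]]; exact: real_roots_size hs.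
move=> [A' [x [/split[s hs [us _]] _]]].
by rewrite /alg_mult (real_roots_mup x hs) count_uniq_mem //; case: (_ \in _).
Qed.

Lemma varying_repeated_inconsistent A : in_qualitative_class P A ->
  varying_repeated_roots n (couplings A) ->
  ~ consistent R P /\ allows_repeated_real_eigenvalues R P.
Proof.
move=> hA [[c [x [hc hx]]] [c1 [c2 [s1 [s2 [hc1 hc2 hs1 hs2 hs]]]]]]; split.
  move=> [m hm]; move/negP: hs; apply; apply/eqP.
  have [A1 hA1 e1] := class_realizes hA hc1.
  have [A2 hA2 e2] := class_realizes hA hc2.
  rewrite -(real_roots_size hs1) -(real_roots_size hs2) -e1 -e2.
  by transitivity m; [exact: hm | apply/esym/hm].
have [A' hA' e] := class_realizes hA hc.
have mx : (2 <= alg_mult A' x)%N.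
  by rewrite /alg_mult mup_geq ?monic_neq0 ?char_poly_monic // e.
exists A', x; split=> //; rewrite eigenvalue_root_char -dvdp_XsubCl.
by rewrite XsubC_dvd ?monic_neq0 ?char_poly_monic // ltnW.
Qed.

End SignPatterns.

Theorem theorem3p5 (R : realType) (n : nat) (hn : (1 <= n <= 5)%N)
    (P : sign_pattern n)
    (hirr : irreducible P) (htri : tridiagonal P) (hdiag : zero_diagonal P) :
  consistent R P <-> ~ allows_repeated_real_eigenvalues R P.
Proof.
case: n hn P hirr htri hdiag => [//|n] hn P hirr htri hdiag.
have [A hA] := in_qualitative_class_nonempty R P.
have [||h|h] := @dichotomy_le4 R n (couplings A); first exact: hn.
- by move=> k; exact: (class_couplings_neq0 hirr htri hA).
- by have [? ?] := constant_simple_consistent hirr htri hdiag hA h.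
- by have [? ?] := varying_repeated_inconsistent hirr htri hdiag hA h; split.
Qed.
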